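(* Let $k\ge 2$ be a fixed integer. The energy of almost any $k$-regular graph $G$ of order $n$ satisfies $$\|G\|_*=\frac{n}{\pi}\left(2k\sqrt{k-1}-k(k-2)\arctan\frac{2\sqrt{k-1}}{k-2}\right)+o(n).$$ That is, writing $c_k=\frac1\pi\left(2k\sqrt{k-1}-k(k-2)\arctan\frac{2\sqrt{k-1}}{k-2}\right)$, for every $\varepsilon>0$ the probability that a uniformly random $k$-regular graph $G$ on $n$ labeled vertices satisfies $\bigl|\|G\|_*-c_k n\bigr|\le\varepsilon n$ tends to $1$ as $n\to\infty$ through integers with $kn$ even.
   Context: Graphs are finite, simple and undirected; the order of a graph is its number of vertices. The energy $\|G\|_*$ of a graph $G$ is the sum of the absolute values of the eigenvalues of its adjacency matrix (counted with multiplicity). ''Almost any $k$-regular graph'' is a synonym of ''randomly chosen $k$-regular graph'', the property holding with probability tending to $1$ as $n\to\infty$. For $k=2$ the term $k(k-2)\arctan\frac{2\sqrt{k-1}}{k-2}$ is read as $0$. *)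

(* Defs.v *)
From HB Require Import structures.
From mathcomp Require Import all_boot all_order all_algebra.
From mathcomp Require Import all_classical all_reals all_analysis.

Set Implicit Arguments.
Unset Strict Implicit.
Unset Printing Implicit Defensive.

Import Order.TTheory GRing.Theory Num.Theory.
Import numFieldNormedType.Exports.

Local Open Scope classical_set_scope.
Local Open Scope ring_scope.

Record sgraph (n : nat) := SGraph {
  edge :> {ffun 'I_n * 'I_n -> bool};
  _ : [forall u, forall v, edge (u, v) == edge (v, u)]
      && [forall u, ~~ edge (u, u)]
}.

HB.instance Definition _ n := [isSub for @edge n].
HB.instance Definition _ n := [Finite of sgraph n by <:].

Definition degree n (G : sgraph n) (u : 'I_n) : nat :=
  #|[set v | G (u, v)]%SET|.

Definition regular k n (G : sgraph n) : bool :=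
  [forall u, degree G u == k].

Definition adjacency (R : realType) n (G : sgraph n) : 'M[R]_n :=
  \matrix_(u, v) (G (u, v))%:R.

(* The adjacency matrix is real symmetric, so all its complex eigenvalues lie
   in R; [mup x (char_poly A)] is the multiplicity of the eigenvalue x, and
   the index set is finite. *)
Definition energy (R : realType) n (G : sgraph n) : R :=
  let A := adjacency R G in
  \sum_(x \in [set x : R | eigenvalue A x]) `|x| *+ mup x (char_poly A).

(* Probability under the uniform distribution on the labeled k-regular graphs
   with vertex set 'I_n; it is 0 by convention when there is no such graph. *)
Definition prob_regular (R : realType) k n (P : pred (sgraph n)) : R :=
  #|[set G : sgraph n | regular k G & P G]%SET|%:R
  / #|[set G : sgraph n | regular k G]%SET|%:R.

(* For k = 2 the last term is 0, because of its factor k - 2. *)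
Definition energy_const (R : realType) (k : nat) : R :=
  pi^-1 * (2 * k%:R * Num.sqrt (k%:R - 1)
           - k%:R * (k%:R - 2)
             * atan (2 * Num.sqrt (k%:R - 1) / (k%:R - 2))).

(* Main.v *)
Require Import Defs.
From mathcomp Require Import complex.
From mathcomp Require Import all_boot all_order all_algebra.
From mathcomp Require Import all_classical all_reals all_analysis.
From mathcomp Require Import zify ring lra.

Import Order.TTheory GRing.Theory Num.Theory.
Import numFieldNormedType.Exports.

Local Open Scope classical_set_scope.
Local Open Scope ring_scope.

Set Implicit Arguments.
Unset Strict Implicit.
Unset Printing Implicit Defensive.

(** The energy is the sum of |x| over the spectrum of the adjacency matrix A,
    so the theorem is a statement on the limiting spectral distribution of a
    random k-regular graph.  All eigenvalues lie in [-k, k], where |x| is a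
    uniform limit of polynomials P (lemma abs_poly_approx), and the sum of P
    over the spectrum is tr P(A) (real_symmetric_spectrum).  Hence it is enough
    to show, for each fixed polynomial P, that tr P(A) is close to n L(P) for
    most graphs, where L(P) is the integral of P for the Kesten-McKay measure,
    and that the same measure gives |x| the integral c_k.

    Convenient polynomials are the nonbacktracking ones, nb_poly: the entries
    of p_r(A) count the walks of length r that never retrace the edge that
    they have just used.  As p_r is monic of degree r, the p_r span all
    polynomials.  Trivially tr p_0(A) = n.  For r > 0, tr p_r(A) is the number
    of closed nonbacktracking walks (mxtrace_nb_poly); such a walk contains a
    cycle of length at most r, so this number is at most a constant times the
    number of edges on short cycles (closed_nb_walks_le).  The average of the
    latter over all k-regular graphs is bounded independently of n
    (sum_short_cycle_edges_le): replacing an edge yz of a short cycle and any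
    far edge cd by the edges cy and dz gives another k-regular graph, in which
    c, y, z, d lie on one walk of bounded length.  There are about n k choices
    of cd, only O(n) such walks in each graph, and the exchange can be undone.  So on
    average tr P(A) = n L(P) + O(1), where L is the linear functional with
    L(p_0) = 1 and L(p_r) = 0 for r > 0 (traces_concentrate_all), and Markov's
    inequality ends this half of the proof (few_bad_energies).

    For the analytic half put q = k - 1 and x = 2 sqrt(q) cos t with t in
    [0, pi].  In this variable the Kesten-McKay measure has the density
    km_weight, and p_r becomes a combination of sin((r+1)t) / sin t and
    sin((r-1)t) / sin t (nb_poly_trig).  The orthogonality relations
    L(p_r) = 0 follow from a two-step recursion in r (km_nb_poly), and the
    integral of |x| is computed from an explicit antiderivative
    (km_integral_abs).

    Finally, k-regular graphs exist as soon as n > k and k n is even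
    (regular_exists), so the probabilities are meaningful for large n. *)


(** * Walks in regular graphs *)

Lemma edgeC n (G : sgraph n) u v : G (u, v) = G (v, u).
Proof.
by case: G => e /= /andP[/forallP h _]; have /forallP/(_ v)/eqP := h u.
Qed.

Lemma edge_irr n (G : sgraph n) u : G (u, u) = false.
Proof. by case: G => e /= /andP[_ /forallP h]; apply/negbTE/h. Qed.

Lemma edge_neq n (G : sgraph n) u v : G (u, v) -> u != v.
Proof. by apply: contraTneq => ->; rewrite edge_irr. Qed.

Lemma degreeE n (G : sgraph n) u : degree G u = (\sum_v G (u, v))%N.
Proof.
rewrite /degree -sum1_card big_mkcond /=.
by apply: eq_bigr => v _; rewrite inE; case: (G _).
Qed.

Lemma regular_sumr k n (G : sgraph n) u :
  regular k G -> (\sum_v G (u, v) = k)%N.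
Proof. by move/forallP/(_ u)/eqP; rewrite degreeE. Qed.

Lemma regular_suml k n (G : sgraph n) v :
  regular k G -> (\sum_u G (u, v) = k)%N.
Proof.
by move=> rG; rewrite -[RHS](regular_sumr v rG); apply: eq_bigr => u _; rewrite edgeC.
Qed.

(** The (x, y) entry of the m-th power of the adjacency matrix. *)
Fixpoint walks n (G : sgraph n) m (x y : 'I_n) : nat :=
  if m is m'.+1 then (\sum_w walks G m' x w * G (w, y))%N else (x == y).

Lemma sum_walks_from k n (G : sgraph n) m x :
  regular k G -> (\sum_y walks G m x y = k ^ m)%N.
Proof.
move=> rG; elim: m => [|m IH] /=.
  rewrite (bigD1 x) //= eqxx big1 // => y; rewrite eq_sym.
  by case: eqP.
rewrite exchange_big /= expnSr -IH big_distrl /=; apply: eq_bigr => w _.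
by rewrite -big_distrr /= (regular_sumr _ rG).
Qed.

Lemma sum_walks_to k n (G : sgraph n) m y :
  regular k G -> (\sum_x walks G m x y = k ^ m)%N.
Proof.
move=> rG; elim: m y => [|m IH] y /=.
  by rewrite (bigD1 y) //= eqxx big1 // => x; case: eqP.
have ky := regular_suml y rG; rewrite exchange_big /= expnS -{1}ky big_distrl /=.
by apply: eq_bigr => w _; rewrite -big_distrl /= IH mulnC.
Qed.

(** The only link needed between counting walks and exhibiting them. *)
Lemma path_walks n (G : sgraph n) x s :
  path (fun u v => G (u, v)) x s -> (0 < walks G (size s) x (last x s))%N.
Proof.
elim/last_ind: s => [|s y IH] /=; first by rewrite eqxx.
rewrite rcons_path size_rcons last_rcons /= => /andP[/IH w0 e].
by rewrite (bigD1 (last x s)) //= e muln1 ltn_addr.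
Qed.

(** * Switchings and short cycles *)

Definition delete_edge n (G : sgraph n) (y z : 'I_n) : rel 'I_n :=
  fun u v => G (u, v) && ((u, v) \notin [:: (y, z); (z, y)]).

(** An edge yz together with a walk from y to z avoiding it closes up to a
    cycle; a walk may be asked for instead of a path, since it can be
    shortened, and this spares the distinctness conditions. The pairs are
    oriented. *)
Definition short_cycle_edges n (G : sgraph n) m : {set 'I_n * 'I_n} :=
  [set e | G e & [exists t : m.-tuple 'I_n,
     path (delete_edge G e.1 e.2) e.1 t && (last e.1 t == e.2)]]%SET.

Section Switching.
Variables (n : nat) (G : sgraph n).
Implicit Types y z c d : 'I_n.

Definition removed y z c d : seq ('I_n * 'I_n) :=
  [:: (y, z); (z, y); (c, d); (d, c)].
Definition added y z c d : seq ('I_n * 'I_n) :=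
  [:: (c, y); (y, c); (d, z); (z, d)].

Definition switch_fun y z c d : {ffun 'I_n * 'I_n -> bool} :=
  [ffun p => (G p && (p \notin removed y z c d)) || (p \in added y z c d)].

Definition switch y z c d : sgraph n := insubd G (switch_fun y z c d).

(** The four vertices must be distinct and the new pairs must not be edges yet,
    so that the result is a simple graph and every degree is preserved. *)
Definition switchable y z c d :=
  [&& G (y, z), G (c, d), ~~ G (c, y), ~~ G (d, z) &
      [&& c != y, c != z, d != y & d != z]].

Lemma switchE y z c d p : switchable y z c d ->
  switch y z c d p =
  (G p && (p \notin removed y z c d)) || (p \in added y z c d).
Proof.
move=> /and5P[yz cd _ _ /and4P[cy cz dy dz]].
rewrite /switch [LHS](_ : _ = val (insubd G (switch_fun y z c d)) p) // val_insubd.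
rewrite ifT; first by rewrite ffunE.
apply/andP; split.
  apply/forallP => u; apply/forallP => v; rewrite !ffunE edgeC !inE !xpair_eqE.
  apply/eqP; congr (_ && ~~ _ || _).
    by do 4!case: (u == _); do 4!case: (v == _).
  by do 4!case: (u == _); do 4!case: (v == _).
apply/forallP => u; rewrite ffunE edge_irr !inE !xpair_eqE /=.
case: (eqVneq u c) => [->|_]; first by rewrite (negbTE cy) (negbTE cz) !andbF.
case: (eqVneq u d) => [->|_] /=; last by rewrite !andbF.
by rewrite (negbTE dz) !andbF.
Qed.

Lemma card_exchange (T : finType) (A : {set T}) a b :
  a \in A -> b \notin A -> #|b |: A :\ a| = #|A|.
Proof.
move=> aA bA; rewrite cardsU1 !inE (negbTE bA) andbF /=.
by rewrite [in RHS](cardsD1 a) aA.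
Qed.

Lemma switch_degree y z c d u : switchable y z c d ->
  degree (switch y z c d) u = degree G u.
Proof.
move=> sw; have /and5P[yz cd ncy ndz /and4P[cy cz dy dz]] := sw.
have yz' := edge_neq yz; have cd' := edge_neq cd.
have H v : (v \in [set v | switch y z c d (u, v)]%SET) =
  (G (u, v) && ((u, v) \notin removed y z c d)) || ((u, v) \in added y z c d).
  by rewrite inE switchE.
have ex a b : G (u, a) -> ~~ G (u, b) ->
  (forall v, (v \in [set v | switch y z c d (u, v)]%SET) =
     (v == b) || (v != a) && G (u, v)) ->
  degree (switch y z c d) u = degree G u.
  move=> ua ub h; rewrite /degree.
  rewrite -(@card_exchange _ [set v | G (u, v)]%SET a b) ?inE //.
  by apply: eq_card => v; rewrite h !inE.
case: (eqVneq u y) => [uy|uy].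
  subst u; apply: (ex z c) => // [|v]; first by rewrite edgeC.
  rewrite H !inE !xpair_eqE eqxx (negbTE yz') (eq_sym y) (negbTE cy).
  rewrite (eq_sym y) (negbTE dy) /= !orbF orbC; congr (_ || _).
  by rewrite andbC.
case: (eqVneq u z) => [uz|uz].
  subst u; apply: (ex y d) => // [||v]; first by rewrite edgeC.
    by rewrite edgeC.
  rewrite H !inE !xpair_eqE eqxx (negbTE uy) (eq_sym z) (negbTE cz).
  rewrite (eq_sym z) (negbTE dz) /= !orbF orbC; congr (_ || _).
  by rewrite andbC.
case: (eqVneq u c) => [uc|uc].
  subst u; apply: (ex d y) => // v.
  rewrite H !inE !xpair_eqE eqxx (negbTE uy) (negbTE uz).
  rewrite (negbTE cd') /= !orbF orbC; congr (_ || _).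
  by rewrite andbC.
case: (eqVneq u d) => [ud|ud].
  subst u; apply: (ex c z) => // [|v]; first by rewrite edgeC.
  rewrite H !inE !xpair_eqE eqxx (negbTE uy) (negbTE uz).
  rewrite (negbTE uc) /= ?orbF orbC; congr (_ || _).
  by rewrite andbC.
apply: eq_card => v; rewrite H !inE !xpair_eqE.
by rewrite (negbTE uy) (negbTE uz) (negbTE uc) (negbTE ud) /= orbF andbT.
Qed.

Lemma switch_regular k y z c d : switchable y z c d ->
  regular k (switch y z c d) = regular k G.
Proof. by move=> sw; apply: eq_forallb => u; rewrite switch_degree. Qed.

(** The switching is undone by the opposite exchange, so a switched graph
    together with y, z, c, d determines the original one. *)
Lemma switchK y z c d p : switchable y z c d ->
  G p = (p \in removed y z c d) ||
        (switch y z c d p && (p \notin added y z c d)).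
Proof.
move=> sw; have /and5P[yz cd ncy ndz _] := sw.
rewrite switchE //; case: (boolP (p \in removed _ _ _ _)) => /= [|_].
  rewrite !inE => /or4P[] /eqP-> //; by rewrite edgeC.
case: (boolP (p \in added _ _ _ _)) => /= [|_]; last by rewrite andbT orbF andbT.
by rewrite orbT !inE => /or4P[] /eqP->; apply/negbTE; rewrite // edgeC.
Qed.

(** The walk that witnessed the short cycle must survive. It could only be
    destroyed through the edge cd, hence the requirement that it avoids c. *)
Lemma switch_path y z c d s : switchable y z c d -> c \notin y :: s ->
  path (delete_edge G y z) y s ->
  path (fun u v => switch y z c d (u, v)) y s.
Proof.
move=> sw cs p; apply: sub_in_path (p) => [|]; last exact: allss.
move=> u v us vs /andP[uv]; rewrite switchE // uv !inE !xpair_eqE !negb_or.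
move=> /andP[-> ->] /=.
have -> : u == c = false by apply: contraNF cs => /eqP<-.
have -> : v == c = false by apply: contraNF cs => /eqP<-.
by rewrite andbF.
Qed.

End Switching.

Lemma switch_inj n (G1 G2 : sgraph n) y z c d :
  switchable G1 y z c d -> switchable G2 y z c d ->
  switch G1 y z c d = switch G2 y z c d -> G1 = G2.
Proof.
move=> s1 s2 e; apply/val_inj/ffunP => p /=.
by rewrite (switchK p s1) (switchK p s2) e.
Qed.

Definition regular_graphs k n : {set sgraph n} := [set G | regular k G]%SET.

(** The avoiding walk is part of the condition, so that different edges cd may
    use different walks from y to z and no walk has to be chosen. *)
Definition good_switch n m (G : sgraph n) (y z c d : 'I_n) :=
  switchable G y z c d &&
  [exists t : m.-tuple 'I_n, [&& path (delete_edge G y z) y t,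
     last y t == z & c \notin y :: t]].

(** Fix one walk from y to z of length m. Among the n k oriented edges cd, the
    unusable ones start on this walk (m + 1 vertices), end at y or z, or have c
    adjacent to y or d adjacent to z: respectively (m + 1) k, 2 k and 2 k^2 at
    most. *)
Lemma good_switch_many (k n m : nat) (G : sgraph n) e : regular k G ->
  e \in short_cycle_edges G m ->
  (n * k <= \sum_c \sum_d good_switch m G e.1 e.2 c d
            + (m.+3 * k + 2 * k ^ 2))%N.
Proof.
case: e => y z rG; rewrite inE => /andP[yz /existsP[t /andP[pt /eqP lt]]].
rewrite /= in pt lt *.
have sumE (S : pred 'I_n) :
  (\sum_c \sum_d (S c * G (c, d)) = \sum_c (S c * k))%N.
  by apply: eq_bigr => c _; rewrite -big_distrr /= (regular_sumr _ rG).
have sumE' (S : pred 'I_n) :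
  (\sum_c \sum_d (S d * G (c, d)) = \sum_c (S c * k))%N.
  rewrite exchange_big /=.
  by apply: eq_bigr => d _; rewrite -big_distrr /= (regular_suml _ rG).
have sum_pred1 a : (\sum_c ((c == a) * k) = k)%N.
  by rewrite (bigD1 a) //= eqxx mul1n big1 ?addn0 // => i /negbTE->.
have -> : (n * k = \sum_(c < n) \sum_d G (c, d))%N.
  by rewrite (eq_bigr _ (fun c _ => regular_sumr c rG)) sum_nat_const card_ord.
pose bad c d := ((c \in y :: t) * G (c, d) + (d == y) * G (c, d)
  + (d == z) * G (c, d) + G (c, y) * G (c, d) + G (d, z) * G (c, d))%N.
have hb c d : (G (c, d) <= good_switch m G y z c d + bad c d)%N.
  rewrite /bad; case cd : (G (c, d)) => //; rewrite !muln1.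
  case: (boolP (c \in y :: t)) => ct; first by rewrite !addn_gt0 !lt0b ?orbT.
  case: (eqVneq d y) => dy; first by rewrite !addn_gt0 !lt0b ?orbT.
  case: (eqVneq d z) => dz; first by rewrite !addn_gt0 !lt0b ?orbT.
  case: (boolP (G (c, y))) => cy; first by rewrite !addn_gt0 !lt0b ?orbT.
  case: (boolP (G (d, z))) => dz'; first by rewrite !addn_gt0 !lt0b ?orbT.
  rewrite !addn0 lt0b /good_switch /switchable yz cd cy dz' dy dz /= andbT.
  apply/andP; split; last by apply/existsP; exists t; rewrite pt lt eqxx.
  apply/andP; split; first by apply: contraNneq ct => ->; rewrite mem_head.
  by apply: contraNneq ct => ->; rewrite -lt mem_last.
apply: (@leq_trans (\sum_(c < n) \sum_d (good_switch m G y z c d + bad c d))%N).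
  by apply: leq_sum => c _; apply: leq_sum => d _; apply: hb.
rewrite (eq_bigr _ (fun c _ => big_split _ _ _ _ _)).
rewrite big_split /= leq_add2l /bad.
under eq_bigr => c _ do rewrite !big_split /=.
rewrite !big_split /= (sumE (fun c => c \in y :: t)).
rewrite (sumE' (fun d => d == y)) (sumE' (fun d => d == z)) !sum_pred1.
rewrite (sumE (fun c => G (c, y))) (sumE' (fun d => G (d, z))).
rewrite -!big_distrl /= !(regular_suml _ rG).
have : (\sum_(i < n) (i \in y :: t) <= m.+1)%N.
  have <- : size (y :: t) = m.+1 by rewrite /= size_tuple.
  apply: leq_trans (card_size _).
  by rewrite -sum1_card [leqRHS]big_mkcond /=; apply: leq_sum => i _; case: (_ \in _).
move=> hS; have := leq_mul hS (leqnn k); rewrite -mulnn.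
move: (\sum_(i < n) _)%N => S; nia.
Qed.

(** Switching is injective on the tuples (G, y, z, c, d), and it lands among
    the tuples where c, y, ..., z, d is a walk of length m + 2: n choices for
    its first vertex, then at most k for each step. *)
Lemma sum_good_switch_le (k n m : nat) :
  (\sum_(G : sgraph n | regular k G) \sum_y \sum_z \sum_c \sum_d
      good_switch m G y z c d
   <= #|regular_graphs k n| * (n * k ^ m.+2))%N.
Proof.
pose T := (sgraph n * (('I_n * 'I_n) * ('I_n * 'I_n)))%type.
pose Src := [set t : T | regular k t.1 &
  good_switch m t.1 t.2.1.1 t.2.1.2 t.2.2.1 t.2.2.2]%SET.
pose Tgt := [set t : T | regular k t.1 & 
  [&& t.1 (t.2.2.1, t.2.1.1), (0 < walks t.1 m t.2.1.1 t.2.1.2)%N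
    & t.1 (t.2.1.2, t.2.2.2)]]%SET.
pose f (t : T) : T := (switch t.1 t.2.1.1 t.2.1.2 t.2.2.1 t.2.2.2, t.2).
have sumT (P : pred (sgraph n)) (F : sgraph n -> _ -> _ -> _ -> _ -> nat) :
  (\sum_(t : T | P t.1) F t.1 t.2.1.1 t.2.1.2 t.2.2.1 t.2.2.2 =
   \sum_(G | P G) \sum_y \sum_z \sum_c \sum_d F G y z c d)%N.
  transitivity (\sum_(G | P G) \sum_(q : ('I_n * 'I_n) * ('I_n * 'I_n))
                 F G q.1.1 q.1.2 q.2.1 q.2.2)%N.
    by rewrite pair_big_dep /=; apply: eq_bigl => t; rewrite andbT.
  apply: eq_bigr => G _.
  rewrite -(pair_bigA _ (fun a b => F G a.1 a.2 b.1 b.2)) /=.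
  rewrite -(pair_bigA _ (fun y z => \sum_(b : 'I_n * 'I_n) F G y z b.1 b.2)%N) /=.
  apply: eq_bigr => y _; apply: eq_bigr => z _.
  by rewrite -(pair_bigA _ (fun c d => F G y z c d)).
have cardSrc : (\sum_(G : sgraph n | regular k G) \sum_y \sum_z \sum_c \sum_d
      good_switch m G y z c d = #|Src|)%N.
  rewrite -(sumT _ (fun G y z c d => nat_of_bool (good_switch m G y z c d))).
  rewrite -sum1_card [LHS]big_mkcond [RHS]big_mkcond /=.
  apply: eq_bigr => t _; rewrite inE.
  by case: (regular _ _) => //=; case: (good_switch _ _ _ _ _ _).
have fP t : t \in Src -> switchable t.1 t.2.1.1 t.2.1.2 t.2.2.1 t.2.2.2.
  by rewrite inE => /and3P[].
have fT t : t \in Src -> f t \in Tgt.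
  move=> tS; have sw := fP _ tS; move: tS; case: t sw => G [[y z] [c d]] /= sw.
  rewrite !inE /= switch_regular // => /and3P[-> _ /existsP[s /and3P[ps /eqP ls cs]]].
  rewrite !switchE // !inE !eqxx !orbT /= andbT.
  by have := path_walks (switch_path sw cs ps); rewrite size_tuple ls.
have finj : {in Src &, injective f}.
  move=> [G1 q1] [G2 q2] /fP/= s1 /fP/= s2 [e eq]; rewrite -eq in s2 e *.
  by rewrite (switch_inj s1 s2 e).
rewrite cardSrc -(card_in_imset finj).
apply: (@leq_trans #|Tgt|).
  by apply/subset_leq_card/fintype.subsetP => _ /imsetP[t tS ->]; apply: fT.
have -> : (#|regular_graphs k n| * (n * k ^ m.+2) =
  \sum_(G : sgraph n | regular k G) \sum_y \sum_z \sum_c \sum_d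
      G (c, y) * walks G m y z * G (z, d))%N.
  rewrite -sum_nat_const; apply: eq_big => [G|G]; rewrite inE // => rG.
  transitivity (\sum_(y < n) k ^ m.+2)%N.
    by rewrite sum_nat_const card_ord.
  apply: eq_bigr => y _.
  transitivity (\sum_z (k * (k * walks G m y z)))%N.
    by rewrite -!big_distrr /= (sum_walks_from _ _ rG) !expnS.
  apply: eq_bigr => z _.
  transitivity (\sum_c G (c, y) * (k * walks G m y z))%N.
    by rewrite -big_distrl /= (regular_suml _ rG).
  apply: eq_bigr => c _; rewrite -big_distrr /= (regular_sumr _ rG).
  by rewrite -mulnA [(k * _)%N]mulnC.
rewrite -(sumT _ (fun G y z c d => G (c, y) * walks G m y z * G (z, d)))%N.
rewrite -sum1_card big_mkcond [leqRHS]big_mkcond /=; apply: leq_sum => t _.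
by rewrite inE; case: (regular _ _) => //=; case: (t.1 _) => //=; case: (t.1 _);
  rewrite ?andbF ?andbT // muln1 mul1n; case: (walks _ _ _ _).
Qed.

(** Double counting: each short-cycle edge has at least n k - O(1) >= n good
    switches, and there are at most n k^(m + 2) results for each regular
    graph. *)
Lemma sum_short_cycle_edges_le (k n m : nat) :
  (1 < k)%N -> (m.+3 * k + 2 * k ^ 2 <= n)%N ->
  (\sum_(G : sgraph n | regular k G) #|short_cycle_edges G m|
   <= #|regular_graphs k n| * k ^ m.+2)%N.
Proof.
move=> k1 nC; case: (posnP n) => [n0|n0]; first by move: nC; rewrite n0; nia.
rewrite -(leq_pmul2l n0).
apply: leq_trans (leq_trans (sum_good_switch_le k n m) _); last by rewrite mulnCA.
rewrite big_distrr /=; apply: leq_sum => G rG.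
rewrite -sum1_card big_distrr /= muln1.
rewrite pair_bigA /= big_mkcond /=.
apply: leq_sum => e _; case: ifP => // eS.
have := good_switch_many rG eS.
by move: (\sum_(c < n) \sum_(d < n) _)%N => A; nia.
Qed.

(** * Nonbacktracking walks *)

(** The last step, from y to z, is recorded because it constrains the next
    one. *)
Fixpoint nb_walks n (G : sgraph n) r (x y z : 'I_n) : nat :=
  if r is r'.+1 then (G (y, z) * \sum_(w | w != z) nb_walks G r' x w y)%N
  else ((x == y) * G (y, z))%N.

Lemma nb_walks_le n (G : sgraph n) r x y z :
  (nb_walks G r x y z <= walks G r x y * G (y, z))%N.
Proof.
elim: r y z => [|r IH] y z //=; rewrite mulnC leq_mul2r; apply/orP; right.
rewrite big_mkcond /=; apply: leq_sum => w _.
by case: ifP => // _; apply: IH.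
Qed.

Lemma sum_nat_gt0 (I : finType) (P : pred I) (F : I -> nat) :
  (0 < \sum_(i | P i) F i)%N -> exists2 i, P i & (0 < F i)%N.
Proof.
rewrite lt0n sum_nat_eq0 => /forallPn[j]; rewrite negb_imply => /andP[Pj Fj].
by exists j; rewrite // lt0n.
Qed.

Lemma nb_walks_path n (G : sgraph n) r x y z : (0 < nb_walks G r x y z)%N ->
  exists v : nat -> 'I_n, [/\ v 0 = x, v r = y, v r.+1 = z,
    forall i, (i <= r)%N -> G (v i, v i.+1) &
    forall i, (i < r)%N -> v i != v i.+2].
Proof.
elim: r y z => [|r IH] y z /=.
  rewrite muln_gt0 !lt0b => /andP[/eqP xy yz].
  by exists (fun i => if i is 0 then x else z); split=> //= -[|i] //; rewrite xy.
rewrite muln_gt0 lt0b => /andP[yz /sum_nat_gt0[w wz /IH[v [v0 vr vr1 vG vN]]]].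
exists (fun i => if (i <= r.+1)%N then v i else z).
split=> [//| | |i|i] /=; first by rewrite leqnn.
- by rewrite ltnn.
- move=> ir; have [->|ir1] := eqVneq i r.+1; first by rewrite leqnn ltnn vr1.
  have {}ir1 : (i < r.+1)%N by rewrite ltn_neqAle ir1.
  by rewrite ir ir1 vG.
- move=> ir; have [->|ir1] := eqVneq i r; first by rewrite leqnSn ltnn vr.
  have {}ir1 : (i < r)%N by rewrite ltn_neqAle ir1.
  by rewrite ltnS ir1 ltnW // vN.
Qed.

Lemma walks_gt0 n (G : sgraph n) (v : nat -> 'I_n) i :
  (forall a, (a < i)%N -> G (v a, v a.+1)) -> (0 < walks G i (v 0) (v i))%N.
Proof.
elim: i => [|i IH] vG /=; first by rewrite eqxx.
rewrite (bigD1 (v i)) //= vG // muln1 ltn_addr // IH // => a ai.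
by rewrite vG // leqW.
Qed.

(** Follow the walk until its first repeated vertex v_j = v_i. Then v_i, ...,
    v_(j-1) are distinct, and j - i >= 3 since there are no loops and no
    backtracking; so the walk from v_i to v_(j-1) does not use the closing
    edge, which is therefore on a short cycle. *)
Lemma closed_nb_walk_short_cycle n (G : sgraph n) r x y :
  (0 < nb_walks G r x y x)%N ->
  exists i m : 'I_r.+1, exists2 e,
    e \in short_cycle_edges G m & (0 < walks G i x e.1)%N.
Proof.
move=> /nb_walks_path[v [v0 vr vr1 vG vN]].
pose rep j := [exists i : 'I_j, v i == v j].
have rep_r : rep r.+1 by apply/existsP; exists ord0; rewrite v0 vr1.
case: (ex_minnP (ex_intro rep _ rep_r)) => j /existsP[[i ij] /= /eqP vij] jmin.
have jr : (j <= r.+1)%N by apply: jmin.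
have vinj a b : (a < b)%N -> (b < j)%N -> v a != v b.
  move=> ab bj; apply/negP => e.
  have : rep b by apply/existsP; exists (Ordinal ab).
  by move/jmin; rewrite leqNgt bj.
have j3 : (i.+2 < j)%N.
  have ir : (i <= r)%N by rewrite -ltnS (leq_trans ij).
  rewrite ltn_neqAle; apply/andP; split; last first.
    rewrite ltn_neqAle ij andbT; apply: contraTneq (vG _ ir) => ->.
    by rewrite vij edge_irr.
  apply: contraTneq jr => ej; rewrite -ej ltnS -ltnNge ltnS leqNgt.
  by apply/negP => /vN; rewrite vij ej eqxx.
(* the length of the walk from v_i to v_(j-1) *)
pose m := (j.-1 - i)%N.
have ir : (i < r.+1)%N by lia.
have mr : (m < r.+1)%N by rewrite /m; lia.
have im : (i + m = j.-1)%N by rewrite /m; lia.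
exists (Ordinal ir), (Ordinal mr), (v i, v j.-1) => /=; last first.
  by rewrite -v0; apply: walks_gt0 => a ai; apply: vG; lia.
have st : size [seq v a | a <- iota i.+1 m] == m by rewrite size_map size_iota.
rewrite inE /= vij edgeC -{2}(@prednK j) ?vG //=; try lia.
apply/existsP; exists (Tuple st); rewrite /= -vij; apply/andP; split; last first.
  rewrite (last_map v) -im; apply/eqP; congr v.
  case: (m) => [|m']; first by rewrite addn0.
  by rewrite -[m'.+1]addn1 iotaD last_cat /= addSnnS addn1.
have nthE b : (b <= m)%N ->
    nth (v i) (v i :: [seq v a | a <- iota i.+1 m]) b = v (i + b)%N.
  case: b => [|b] bm /=; first by rewrite addn0.
  by rewrite (nth_map i) ?size_iota // nth_iota // addSnnS.
apply/(pathP (v i)) => b; rewrite size_map size_iota => bm.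
rewrite -[nth _ [seq _ | _ <- _] b]/(nth (v i) (v i :: [seq v a | a <- _ m]) b.+1).
rewrite !nthE ?(ltnW bm) // /delete_edge addnS vG /=; last by lia.
have h1 : v (i + b).+1 != v i by rewrite eq_sym vinj //; lia.
rewrite !inE !xpair_eqE (negbTE h1) andbF orbF negb_and.
case: b bm {h1} => [|b] bm; last first.
  by apply/orP; left; rewrite eq_sym; apply: vinj; lia.
by apply/orP; right; rewrite addn0; apply: vinj; lia.
Qed.

Definition closed_nb_walks n (G : sgraph n) r : nat :=
  (\sum_x \sum_y nb_walks G r x y x)%N.

(** Only the vertices x within distance r of a short-cycle edge have closed
    nonbacktracking walks, each at most k^(r + 1) of them, and at most 1 + k +
    ... + k^r vertices are that near to a given edge. *)
Lemma closed_nb_walks_le k n (G : sgraph n) r : regular k G ->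
  (closed_nb_walks G r <= k ^ r.+1 * (\sum_(i < r.+1) k ^ i) *
     \sum_(m < r.+1) #|short_cycle_edges G m|)%N.
Proof.
move=> rG.
pose B x := (\sum_(i < r.+1) \sum_(m < r.+1) \sum_(e in short_cycle_edges G m)
  walks G i x e.1)%N.
have hB x : (\sum_y nb_walks G r x y x <= k ^ r.+1 * B x)%N.
  have [->|] := eqVneq (\sum_y nb_walks G r x y x)%N 0%N; first by rewrite leq0n.
  rewrite -lt0n => /sum_nat_gt0[y _ /closed_nb_walk_short_cycle[i [m [e em wi]]]].
  have Bx : (0 < B x)%N.
    rewrite /B (bigD1 i) //= (bigD1 m) //= (bigD1 e) //=.
    by rewrite -!addnA ltn_addr.
  apply: leq_trans (leq_pmulr _ Bx).
  apply: (@leq_trans (walks G r.+1 x x)).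
    by rewrite /=; apply: leq_sum => w _; apply: nb_walks_le.
  by rewrite -(sum_walks_from r.+1 x rG) (bigD1 x) //= leq_addr.
apply: (@leq_trans (\sum_x k ^ r.+1 * B x)%N).
  by apply: leq_sum => x _; apply: hB.
rewrite -big_distrr /= -mulnA leq_mul2l; apply/orP; right.
rewrite exchange_big /= big_distrl /=; apply: leq_sum => i _.
rewrite exchange_big /= big_distrr /=; apply: leq_sum => m _.
rewrite exchange_big /= -sum1_card big_distrr /=; apply: leq_sum => e _.
by rewrite (sum_walks_to _ _ rG) muln1.
Qed.

(** * Existence of regular graphs *)

(** The Cayley graph of the cyclic group with connection set S. *)
Lemma regular_circulant n (S : {set 'I_n.+1}) :
  0 \notin S -> (forall x, (- x \in S) = (x \in S)) ->
  exists G : sgraph n.+1, regular #|S| G.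
Proof.
move=> S0 SN; pose e := [ffun p : 'I_n.+1 * 'I_n.+1 => p.2 - p.1 \in S].
have eP : [forall u, forall v, e (u, v) == e (v, u)] && [forall u, ~~ e (u, u)].
  apply/andP; split; apply/forallP => u; last by rewrite ffunE subrr.
  by apply/forallP => v; rewrite !ffunE /= -opprB SN.
exists (SGraph eP); apply/forallP => u; apply/eqP.
rewrite -(card_imset S (addrI u)); apply: eq_card => v.
rewrite inE /= ffunE /=; apply/idP/imsetP => [vS|[x xS ->]].
  by exists (v - u); rewrite // addrC subrK.
by rewrite addrC addKr.
Qed.

(** Connection set: 1, ..., h and their opposites with h = floor(k / 2), and
    for odd k also n / 2, which is its own opposite. *)
Lemma regular_exists k n : (k < n)%N -> ~~ odd (k * n) ->
  exists G : sgraph n, regular k G.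
Proof.
case: n => [//|n] kn okn; pose h := k./2.
pose A : {set 'I_n.+1} := [set inord (nat_of_ord i).+1 | i in [set: 'I_h]%SET]%SET.
have hk : (h.*2 <= k)%N by rewrite -[leqRHS]odd_double_half leq_addl.
have hn (i : 'I_h) : (i.+1 < n.+1)%N by have := ltn_ord i; lia.
have AP x : x \in A -> (0 < x <= h)%N.
  by case/imsetP => i _ ->; rewrite inordK // ltn_ord.
have cardA : #|A| = h.
  rewrite card_imset ?cardsT ?card_ord // => i j /(congr1 (@nat_of_ord _)).
  by rewrite !inordK // => -[/val_inj].
pose B := [set - x | x in A]%SET.
have oppE (x : 'I_n.+1) : (0 < x)%N -> nat_of_ord (- x) = (n.+1 - x)%N.
  by move=> x0; rewrite /= modn_small // ltn_subrL x0.
have BP x : x \in B -> (n.+1 - h <= x)%N.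
  case/imsetP => y /AP/andP[y0 yh] ->; rewrite oppE //.
  by rewrite leq_sub2l.
have cardB : #|B| = h by rewrite card_imset //; apply: oppr_inj.
have memB x : (- x \in B) = (x \in A) by rewrite (mem_imset _ _ oppr_inj).
have memA x : (- x \in A) = (x \in B) by rewrite -memB opprK.
have dAB : A :&: B = finset.set0.
  apply/setP => x; rewrite !inE; apply/negP => /andP[/AP xA /BP xB].
  by move: xA xB; lia.
have cardAB : #|A :|: B| = h.*2 by rewrite cardsU dAB cards0 subn0 cardA cardB addnn.
have AB0 : 0 \notin A :|: B.
  by rewrite inE; apply/negP => /orP[/AP|/BP] //=; lia.
have ABN x : (- x \in A :|: B) = (x \in A :|: B).
  by rewrite !finset.in_setU memA memB orbC.
case: (boolP (odd k)) => ok; last first.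
  have <- : #|A :|: B| = k by rewrite cardAB -[RHS]odd_double_half (negbTE ok).
  exact: regular_circulant.
have on : ~~ odd n.+1 by move: okn; rewrite oddM ok.
pose m : 'I_n.+1 := inord n.+1./2.
have n2 : (n.+1./2.*2 = n.+1)%N.
  by rewrite -[RHS]odd_double_half (negbTE on).
have hm : (h < n.+1./2)%N.
  by rewrite -ltn_double n2; apply: leq_ltn_trans kn.
have mE : nat_of_ord m = n.+1./2 by rewrite inordK //; lia.
have mAB : m \notin A :|: B.
  by rewrite inE; apply/negP => /orP[/AP|/BP]; rewrite mE; lia.
have mN : - m = m.
  by apply/val_inj => /=; rewrite -[LHS]/(nat_of_ord (- m)) oppE mE; lia.
have <- : #|m |: (A :|: B)| = k.
  by rewrite cardsU1 mAB cardAB -[RHS]odd_double_half ok.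
apply: regular_circulant.
  rewrite inE negb_or AB0 andbT inE -val_eqE /=.
  by rewrite -[nat_of_ord m]/(nat_of_ord m) mE; apply/eqP; lia.
by move=> x; rewrite !in_setU1 ABN -{1}mN (inj_eq oppr_inj).
Qed.

(** * Nonbacktracking polynomials *)

(** The coefficient is k at the first step because a walk of length 2 that
    returns to its start can do so through each of the k neighbours; afterwards
    one neighbour is excluded. *)
Fixpoint nb_poly (R : comNzRingType) (k r : nat) : {poly R} :=
  match r with
  | 0 => 1
  | r1.+1 => match r1 with
    | 0 => 'X
    | r2.+1 => nb_poly R k r1 * 'X -
        (if r2 is 0 then k else k.-1)%:R *: nb_poly R k r2
    end
  end.

Arguments nb_poly : simpl never.

Lemma nb_polySS (R : comNzRingType) (k r : nat) :
  nb_poly R k r.+2 = nb_poly R k r.+1 * 'X -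
    (if r is 0 then k else k.-1)%:R *: nb_poly R k r.
Proof. by []. Qed.

Lemma nb_walks_edge n (G : sgraph n) r x y z :
  (G (y, z) * nb_walks G r x y z = nb_walks G r x y z)%N.
Proof. by case: r => [|r] /=; case: (G _); rewrite ?muln0 ?mul0n ?mul1n. Qed.

(** The walks ending at z are extended by each neighbour of z except the one
    that they come from. *)
Lemma sum_nb_walks_last k n (G : sgraph n) r x z : regular k G ->
  (\sum_y nb_walks G r x z y =
   if r is r'.+1 then k.-1 * \sum_w nb_walks G r' x w z else k * (x == z))%N.
Proof.
move=> rG; case: r => [|r] /=.
  by rewrite -big_distrr /= (regular_sumr _ rG) mulnC.
under eq_bigr do rewrite big_distrr /=.
rewrite (exchange_big_dep predT) //= big_distrr /=; apply: eq_bigr => w _.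
under eq_bigr do rewrite mulnC.
rewrite -big_distrr /= mulnC -nb_walks_edge.
case wz: (G (w, z)); last by rewrite mul0n !muln0.
congr (_ * _)%N; rewrite -(regular_sumr z rG) [in RHS](bigD1 w) //= edgeC wz /=.
by apply: eq_bigl => y; rewrite eq_sym.
Qed.

(** Extending by an edge either keeps the walk nonbacktracking or undoes its
    last step. *)
Lemma nb_walks_step k n (G : sgraph n) r x z : regular k G ->
  (\sum_w (\sum_y nb_walks G r x y w) * G (w, z) =
   \sum_w nb_walks G r.+1 x w z +
   if r is r'.+1 then k.-1 * \sum_w nb_walks G r' x w z else k * (x == z))%N.
Proof.
move=> rG; rewrite -sum_nb_walks_last // -big_split /=; apply: eq_bigr => w _.
rewrite mulnC (bigD1 z) //= mulnDr addnC; congr (_ + _)%N.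
by rewrite edgeC nb_walks_edge.
Qed.

Lemma horner_mx_nb_poly (R : realType) (k n : nat) (G : sgraph n.+1) r x z :
  regular k G ->
  horner_mx (adjacency R G) (nb_poly R k r.+1) x z =
  (\sum_y nb_walks G r x y z)%N%:R.
Proof.
move=> rG; set A := adjacency R G.
pose P r := forall a b, horner_mx A (nb_poly R k r.+1) a b =
  (\sum_y nb_walks G r a y b)%N%:R.
have step p a b : P p -> horner_mx A (nb_poly R k p.+1 * 'X) a b =
  (\sum_w nb_walks G p.+1 a w b +
   if p is r'.+1 then k.-1 * \sum_w nb_walks G r' a w b else k * (a == b))%N%:R.
  move=> IH; rewrite -nb_walks_step // rmorphM /= horner_mx_X mxE natr_sum.
  by apply: eq_bigr => w _; rewrite IH !mxE natrM.
suff H p : P p /\ P p.+1 by have [->] := H r.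
elim: p => [|p [IH1 IH2]].
  have P0 : P 0%N.
    move=> a b; rewrite [nb_poly _ _ _]/('X) horner_mx_X mxE; congr (_%:R).
    rewrite (bigD1 a) //= eqxx mul1n big1 ?addn0 // => i; rewrite eq_sym.
    by move/negbTE->; rewrite mul0n.
  split=> // a b; rewrite nb_polySS rmorphB /= linearZ /= mxE step //.
  by rewrite [nb_poly _ _ _]/1 rmorph1 !mxE natrD natrM addrK.
split=> // a b; rewrite nb_polySS rmorphB /= linearZ /= mxE step //.
by rewrite mxE mxE IH1 natrD natrM addrK.
Qed.

Lemma mxtrace_nb_poly (R : realType) (k n : nat) (G : sgraph n.+1) r :
  regular k G ->
  \tr (horner_mx (adjacency R G) (nb_poly R k r.+1)) = (closed_nb_walks G r)%:R.
Proof.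
move=> rG; rewrite natr_sum; apply: eq_bigr => x _.
exact: horner_mx_nb_poly.
Qed.

(** * Spectra of real symmetric matrices and energy *)

(** Written without an inverse matrix, so that the determinants can be compared
    in the polynomial ring and the factor det P cancelled there. *)
Lemma char_poly_conj (F : fieldType) n (P A D : 'M[F]_n) :
  P \in unitmx -> P *m A = D *m P -> char_poly A = char_poly D.
Proof.
move=> Pu PA; pose P' := map_mx (@polyC F) P.
have : P' *m char_poly_mx A = char_poly_mx D *m P'.
  rewrite /char_poly_mx mulmxBr mulmxBl -!map_mxM PA; congr (_ - _).
  by rewrite scalar_mxC.
move/(congr1 determinant); rewrite !det_mulmx [RHS]mulrC; apply: mulfI.
by rewrite det_map_mx polyC_eq0 -unitfE -unitmxE.
Qed.

Section RealSymmetric.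
Variables (R : realType) (n : nat) (A : 'M[R]_n.+1).
Hypothesis Asym : A^T = A.

Local Notation toC := (real_complex R).

(** Over the complex numbers the matrix is hermitian, hence unitarily
    diagonalizable with real eigenvalues; both conclusions are identities
    between real quantities and descend along the embedding. *)
Lemma real_symmetric_spectrum : exists d : 'I_n.+1 -> R,
  char_poly A = \prod_i ('X - (d i)%:P) /\
  forall Q, \tr (horner_mx A Q) = \sum_i Q.[d i].
Proof.
pose B := map_mx toC A.
have Breal : B \is a mxOver Num.real.
  by apply/mxOverP => i j; rewrite mxE; apply/complex_realP; exists (A i j).
have Bsym : B \is symmetricmx.
  apply/is_hermitianmxP; rewrite expr0 scale1r.
  by rewrite [RHS]map_mx_id // /B map_trmx Asym.
have Bherm : B \is hermsymmx by apply: realsym_hermsym.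
have /hermitian_normalmx/orthomx_spectralP := Bherm.
set P := spectralmx B; set sp := spectral_diag B => eB.
have Pu : P \in unitmx by apply: spectral_unit.
have spE i : sp 0 i = toC (complex.Re (sp 0 i)).
  by have /mxOverP/(_ 0 i)/RRe_real-> := hermitian_spectral_diag_real Bherm.
exists (fun i => complex.Re (sp 0 i)); split.
  apply: (map_inj_poly (@complexI R) (rmorph0 _)).
  rewrite map_char_poly -/B rmorph_prod /=.
  transitivity (\prod_i ('X - (sp 0 i)%:P)); last first.
    by apply: eq_bigr => i _; rewrite map_polyXsubC /= [in LHS]spE.
  rewrite (@char_poly_conj _ _ P B (diag_mx sp)) //; last first.
    by rewrite {1}eB !mulmxA mulmxV // mul1mx.
  rewrite char_poly_trig ?diag_mx_is_trig //.
  by apply: eq_bigr => i _; rewrite mxE eqxx mulr1n.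
move=> Q; apply: (@complexI R); rewrite -trace_map_mx map_horner_mx -/B eB.
rewrite horner_mx_uconjC // mxtrace_mulC mulmxA mulmxV // mul1mx.
rewrite horner_mx_diag mxtrace_diag rmorph_sum /=; apply: eq_bigr => i _.
by rewrite mxE {1}spE horner_map.
Qed.
End RealSymmetric.

Lemma energyE (R : realType) n (G : sgraph n) (d : 'I_n -> R) :
  char_poly (adjacency R G) = \prod_i ('X - (d i)%:P) ->
  energy R G = \sum_i `|d i|.
Proof.
move=> chA; pose s := [seq d i | i <- enum 'I_n].
have {}chA : char_poly (adjacency R G) = \prod_(x <- s) ('X - x%:P).
  by rewrite chA big_map big_enum.
have es : [set x : R | eigenvalue (adjacency R G) x] = [set` undup s].
  apply/seteqP; suff e x : eigenvalue (adjacency R G) x = (x \in undup s).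
    by split=> x /=; rewrite e.
  by rewrite eigenvalue_root_char chA mem_undup -root_prod_XsubC.
rewrite /energy /= es -fsbig_seq ?undup_uniq // chA.
under eq_bigr do rewrite mu_prod_XsubC.
transitivity (\sum_(x <- s) `|x|); last by rewrite big_map big_enum.
rewrite -[RHS]big_undup_iterop_count; apply: eq_bigr => x _.
by rewrite Monoid.iteropE iter_addr_0.
Qed.

Lemma adjacency_sym (R : realType) n (G : sgraph n) :
  (adjacency R G)^T = adjacency R G.
Proof. by apply/matrixP => u v; rewrite !mxE edgeC. Qed.

(** Compare both sides of the eigenvector equation at a coordinate of largest
    modulus. *)
Lemma regular_eigenvalue_le (R : realType) k n (G : sgraph n) x :
  regular k G -> eigenvalue (adjacency R G) x -> `|x| <= k%:R.
Proof.
move=> rG /eigenvalueP[v vA v0].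
have [j0 vj0] : exists j, v 0 j != 0.
  by apply/rV0Pn.
case: (@arg_maxP _ _ _ j0 predT (fun j => `|v 0 j|)) => // j _ jmax.
have vj : 0 < `|v 0 j| by apply: lt_le_trans (jmax j0 _); rewrite ?normr_gt0.
rewrite -(ler_pM2r vj) -normrM.
have /matrixP/(_ 0 j) := vA; rewrite !mxE => <-.
apply: le_trans (ler_norm_sum _ _ _) _.
rewrite -(regular_suml j rG) natr_sum mulr_suml; apply: ler_sum => u _.
by rewrite !mxE normrM normr_nat mulrC ler_wpM2l ?ler0n //; apply: jmax.
Qed.

(** * Polynomial approximation of the absolute value *)

(** The classical iteration for the square root of x^2, increasing from 0. *)
Fixpoint abs_poly (R : realType) (m : nat) : {poly R} :=
  if m is m'.+1 then
    abs_poly R m' + 2^-1 *: ('X^2 - abs_poly R m' ^+ 2)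
  else 0.

(** For a = |x| <= 1 the error e = a - y becomes e (1 - a + e / 2) <= e - e^2 /
    2, because e <= a; and 2 / (m + 2) is a supersolution of this recursion. *)
Lemma abs_poly_bound (R : realType) m (x : R) : `|x| <= 1 ->
  [/\ 0 <= (abs_poly R m).[x], (abs_poly R m).[x] <= `|x| &
      `|x| - (abs_poly R m).[x] <= 2 / m.+2%:R].
Proof.
move=> x1; elim: m => [|m [IH0 IH1 IH2]] /=.
  by rewrite horner0 subr0 divff // normr_ge0.
rewrite !hornerE -[x ^+ 2]real_normK ?num_real //.
move: (normr_ge0 x) x1 IH0 IH1 IH2; set a := `|x|.
move: (abs_poly R m).[x] => y a0 a1 y0 ya ey.
have m0 : 0 < m.+2%:R :> R by rewrite ltr0n.
have m1 : 1 <= m.+1%:R :> R by rewrite ler1n.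
set t := 2 / m.+2%:R in ey.
have mt : m.+2%:R * t = 2 by rewrite /t mulrC divfK ?gt_eqF.
have m2E : m.+2%:R = m.+1%:R + 1 :> R by rewrite natr1.
have t0 : 0 < t by rewrite divr_gt0.
have t1 : t <= 1 by nra.
split; [nra|nra|].
apply: (@le_trans _ _ (t - t ^+ 2 / 2)); first by nra.
rewrite ler_pdivlMr ?ltr0n //.
have -> : m.+3%:R = m.+2%:R + 1 :> R by rewrite natr1.
nra.
Qed.

Lemma abs_poly_approx (R : realType) (M eps : R) : 0 < M -> 0 < eps ->
  exists P : {poly R}, forall x, `|x| <= M -> `| `|x| - P.[x] | <= eps.
Proof.
move=> M0 eps0.
have [m hm] : exists m : nat, 2 * M / eps < m%:R.
  exists (Num.bound (2 * M / eps)); apply: archi_boundP.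
  by rewrite divr_ge0 ?mulr_ge0 ?ltW.
exists (M *: (abs_poly R m \Po (M^-1 *: 'X))) => x xM.
rewrite !hornerE horner_comp !hornerE.
have xM1 : `|M^-1 * x| <= 1.
  by rewrite normrM gtr0_norm ?invr_gt0 // mulrC ler_pdivrMr // mul1r.
have [h0 h1 h2] := abs_poly_bound m xM1.
have -> : `|x| = M * `|M^-1 * x|.
  by rewrite normrM (gtr0_norm (x := M^-1)) ?invr_gt0 // mulVKf ?gt_eqF.
rewrite -mulrBr normrM (gtr0_norm M0) ger0_norm ?subr_ge0 //.
rewrite -ler_pdivlMl //. apply: le_trans h2 _.
rewrite ler_pdivrMr ?ltr0n // -mulrA ler_pdivlMl //.
move: hm; rewrite ltr_pdivrMr // mulrC => /ltW/le_trans; apply.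
by rewrite mulrC ler_pM2l // ler_nat; lia.
Qed.

(** * Integrals of continuous functions over a segment *)

Section IntegralOfContinuous.
Context {R : realType}.
Local Notation mu := (@lebesgue_measure R).
Implicit Types (f g F : R -> R) (a b : R).

Definition itv_integral f a b : R := \int[mu]_(x in `[a, b]) f x.

Lemma continuous_integrable f a b : continuous f ->
  mu.-integrable `[a, b] (EFin \o f).
Proof.
move=> cf; apply: continuous_compact_integrable; first exact: segment_compact.
exact: continuous_subspaceT.
Qed.

Lemma itv_integralD f g a b : continuous f -> continuous g ->
  itv_integral (fun x => f x + g x) a b = itv_integral f a b + itv_integral g a b.
Proof.
by move=> cf cg; rewrite /itv_integral RintegralD //; apply: continuous_integrable.
Qed.

Lemma itv_integralZ c f a b : continuous f ->
  itv_integral (fun x => c * f x) a b = c * itv_integral f a b.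
Proof.
by move=> cf; rewrite /itv_integral RintegralZl //; apply: continuous_integrable.
Qed.

Lemma le_itv_integral f g a b : continuous f -> continuous g ->
  (forall x, a <= x <= b -> f x <= g x) -> itv_integral f a b <= itv_integral g a b.
Proof.
move=> cf cg fg; apply: le_Rintegral => //; try exact: continuous_integrable.
Qed.

Lemma itv_integral_FTC f F a b : a < b -> continuous f ->
  (forall x : R, is_derive x 1 F (f x)) -> itv_integral f a b = F b - F a.
Proof.
move=> ab cf dF.
have cF : continuous F.
  by move=> x; apply/differentiable_continuous/derivable1_diffP; have [] := dF x.
rewrite /itv_integral /Rintegral (@continuous_FTC2 _ f F) //.
- exact: continuous_subspaceT.
- split; [by move=> x _; have [] := dF x| |].
    by apply: cvg_at_right_filter; apply: cF.
  by apply: cvg_at_left_filter; apply: cF.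
- by move=> x _; rewrite derive1E; apply: derive_val.
Qed.

Lemma itv_integral_split f a c b : a <= c -> c <= b -> continuous f ->
  itv_integral f a b = itv_integral f a c + itv_integral f c b.
Proof.
move=> ac cb cf; apply/eqP; rewrite addrC -subr_eq /itv_integral.
rewrite (@Rintegral_itvB _ f (BLeft a) (BRight b) c) ?bnd_simp //; last first.
  exact: continuous_integrable.
rewrite Rintegral_itv_obnd_cbnd //.
have := continuous_integrable c b cf; apply: integrableS => //.
exact: subset_itv_oc_cc.
Qed.

Lemma eq_itv_integral f g a b : (forall x, a <= x <= b -> f x = g x) ->
  itv_integral f a b = itv_integral g a b.
Proof.
by move=> fg; apply: eq_Rintegral => x; rewrite inE /= in_itv /=; apply: fg.
Qed.

Lemma itv_integral_cst c a b : a < b -> itv_integral (fun=> c) a b = c * (b - a).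
Proof.
have dF (x : R) : is_derive x 1 (fun x => c * x) c.
  by apply: is_derive_eq; rewrite /GRing.scale /= mulr1.
by move=> ab; rewrite (itv_integral_FTC ab _ dF) ?mulrBr // => x; apply: cvg_cst.
Qed.

Lemma norm_itv_integral_le f g a b : continuous f -> continuous g ->
  (forall x, a <= x <= b -> `|f x| <= g x) -> `|itv_integral f a b| <= itv_integral g a b.
Proof.
move=> cf cg fg; rewrite ler_norml; apply/andP; split; last first.
  by apply: le_itv_integral => // x /fg; apply: le_trans; apply: ler_norm.
rewrite -mulN1r -itv_integralZ //; apply: le_itv_integral => //.
  by move=> x; apply: cvgM; [apply: cvg_cst|apply: cg].
by move=> x /fg; rewrite ler_norml mulN1r => /andP[].
Qed.

Lemma derivable_continuous f : (forall x : R, derivable f x 1) -> continuous f.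
Proof.
by move=> df x; apply/differentiable_continuous/derivable1_diffP/df.
Qed.

End IntegralOfContinuous.

(** * Trigonometric identities *)

Section Trigonometry.
Context {R : realType}.
Implicit Types (t s q : R) (m r : nat).

Lemma sin_mulnSS m t :
  sin (m.+2%:R * t) = 2 * cos t * sin (m.+1%:R * t) - sin (m%:R * t).
Proof.
have -> : m.+2%:R * t = m.+1%:R * t + t by rewrite -[m.+2%:R]natr1 mulrDl mul1r.
have -> : m%:R * t = m.+1%:R * t - t by rewrite -[m.+1%:R]natr1 mulrDl mul1r addrK.
by rewrite sinD sinB; ring.
Qed.

Lemma cos_mulnSS m t :
  cos (m.+2%:R * t) = 2 * cos t * cos (m.+1%:R * t) - cos (m%:R * t).
Proof.
have -> : m.+2%:R * t = m.+1%:R * t + t by rewrite -[m.+2%:R]natr1 mulrDl mul1r.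
have -> : m%:R * t = m.+1%:R * t - t by rewrite -[m.+1%:R]natr1 mulrDl mul1r addrK.
by rewrite cosD cosB; ring.
Qed.

Lemma sin_natpi m : sin (m%:R * pi) = 0 :> R.
Proof.
suff [] : sin (m%:R * pi) = 0 :> R /\ sin (m.+1%:R * pi) = 0 :> R by [].
elim: m => [|m [IH1 IH2]]; first by rewrite mul0r sin0 mul1r sinpi.
by split=> //; rewrite sin_mulnSS IH1 IH2 mulr0 subr0.
Qed.

Lemma integral_sin_sin m : 
  itv_integral (fun t : R => sin (m.+2%:R * t) * sin t) 0 pi = 0.
Proof.
have [c cE] : exists c : R, c = m.+2%:R by exists m.+2%:R.
rewrite -cE; have c1 : c ^+ 2 - 1 != 0.
  have c2 : 2 <= c by rewrite cE ler_nat.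
  by rewrite gt_eqF // subr_gt0 exprn_egt1 // (lt_le_trans _ c2) // ltr1n.
have dF (t : R) : is_derive t 1 (fun t => (c ^+ 2 - 1)^-1 *
    (sin (c * t) * cos t - c * (cos (c * t) * sin t))) (sin (c * t) * sin t).
  by apply: is_derive_eq; rewrite /GRing.scale /=; field.
rewrite (itv_integral_FTC (pi_gt0 R) _ dF).
  by rewrite cE sin_natpi sinpi !(sin0, mulr0, mul0r, subrr).
by apply: derivable_continuous => x; apply: ex_derive.
Qed.

Lemma integral_sin2 : itv_integral (fun t : R => sin t * sin t) 0 pi = pi / 2.
Proof.
have dF (t : R) : is_derive t 1 (fun t => 2^-1 * (t - sin t * cos t)) (sin t * sin t).
  apply: is_derive_eq; rewrite /GRing.scale /=.
  have := cos2Dsin2 t; move: (cos t) (sin t) => c s cs.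
  have -> : s * - s + c * c = 1 - 2 * (s * s) by move: cs; rewrite !expr2 => cs; lra.
  by field.
rewrite (itv_integral_FTC (pi_gt0 R) _ dF).
  by rewrite sinpi sin0 !mul0r !subr0 mulr0 subr0 mulrC.
by apply: derivable_continuous => x; apply: ex_derive.
Qed.

(** Both sides satisfy the recursion of nb_poly. Multiplying by s clears the
    power s^(r - 1), which would be negative for r = 0. *)
Lemma nb_poly_trig (k : nat) s r t : (0 < k)%N -> s ^+ 2 = k.-1%:R ->
  s * (nb_poly R k r.+1).[2 * s * cos t] * sin t =
  s ^+ r * (s ^+ 2 * sin (r.+2%:R * t) - sin (r%:R * t)).
Proof.
move=> k0 sk; have kE : k%:R = s ^+ 2 + 1 by rewrite sk natr1 prednK.
set x := 2 * s * cos t.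
suff H p : s * (nb_poly R k p.+1).[x] * sin t =
    s ^+ p * (s ^+ 2 * sin (p.+2%:R * t) - sin (p%:R * t)) /\
    s * (nb_poly R k p.+2).[x] * sin t =
    s ^+ p.+1 * (s ^+ 2 * sin (p.+3%:R * t) - sin (p.+1%:R * t)) by case: (H r).
elim: p => [|p [IH1 IH2]].
  rewrite [nb_poly R k 1]/('X) nb_polySS [nb_poly R k 1]/('X) [nb_poly R k 0]/1.
  rewrite !hornerE kE /x !sin_mulnSS mulr0n mulr1n mul0r sin0 mul1r.
  by split; rewrite /=; ring.
split=> //; rewrite nb_polySS hornerD hornerN hornerMX hornerZ -sk.
transitivity (x * (s * (nb_poly R k p.+2).[x] * sin t) -
  s ^+ 2 * (s * (nb_poly R k p.+1).[x] * sin t)); first by ring.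
rewrite IH1 IH2 [sin (p.+4%:R * t)]sin_mulnSS.
rewrite (_ : sin (p%:R * t) = 2 * cos t * sin (p.+1%:R * t) - sin (p.+2%:R * t)).
  by rewrite /x !exprS; ring.
by rewrite sin_mulnSS; ring.
Qed.

(** For k = 2 these are rescaled Chebyshev polynomials. This case is separate
    because the denominator of the general density vanishes at 0 and pi. *)
Lemma nb_poly2_trig r t :
  (nb_poly R 2 r.+1).[2 * cos t] = 2 * cos (r.+1%:R * t).
Proof.
suff H p : (nb_poly R 2 p.+1).[2 * cos t] = 2 * cos (p.+1%:R * t) /\
   (nb_poly R 2 p.+2).[2 * cos t] = 2 * cos (p.+2%:R * t) by case: (H r).
elim: p => [|p [IH1 IH2]].
  rewrite [nb_poly R 2 1]/('X) nb_polySS [nb_poly R 2 1]/('X) [nb_poly R 2 0]/1.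
  by rewrite !hornerE cos_mulnSS mulr0n mulr1n mul0r cos0 mul1r; split; rewrite /=; ring.
split=> //; rewrite nb_polySS hornerD hornerN hornerMX hornerZ IH1 IH2.
by rewrite [in RHS]cos_mulnSS mul1r /=; ring.
Qed.
End Trigonometry.

(** * Orthogonality relations *)

Section KestenMcKay.
Context {R : realType}.
Implicit Types (t q s x : R) (m r k : nat).

(** Equal to 1 - 2 q cos(2t) + q^2 and to k^2 - x^2 for x = 2 sqrt(q) cos t, k
    = q + 1. *)
Definition km_denom q t : R := (q - 1) ^+ 2 + 4 * q * sin t ^+ 2.

Lemma km_denom_ge q t : 0 <= q -> (q - 1) ^+ 2 <= km_denom q t.
Proof. by move=> q0; rewrite lerDl mulr_ge0 ?sqr_ge0 // mulr_ge0. Qed.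

Lemma km_denom_gt0 q t : 1 < q -> 0 < km_denom q t.
Proof.
move=> q1; apply: lt_le_trans (km_denom_ge _ _); last by rewrite ltW // (lt_trans _ q1).
by rewrite exprn_gt0 // subr_gt0.
Qed.

Lemma continuous_div_km_denom (f : R -> R) q : 1 < q -> continuous f ->
  continuous (fun t => f t / km_denom q t).
Proof.
move=> q1 cf t; apply: cvgM; first exact: cf.
apply: cvgV; first by rewrite gt_eqF // km_denom_gt0.
have : continuous (km_denom q).
  by rewrite /km_denom; apply: derivable_continuous => x; apply: ex_derive.
exact.
Qed.

(** Up to a constant, p_(m+1) times the Kesten-McKay density. *)
Definition km_moment_fun q m t : R :=
  (q * sin (m.+2%:R * t) - sin (m%:R * t)) * sin t / km_denom q t.

Lemma continuous_km_moment_fun q m : 1 < q -> continuous (km_moment_fun q m).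
Proof.
move=> q1; apply: continuous_div_km_denom => //.
by apply: derivable_continuous => t; apply: ex_derive.
Qed.

(** The denominator is 1 + q^2 - 2 q cos(2t), and multiplying sin((m+2)t) by 2
    cos(2t) gives sin((m+4)t) + sin(mt). *)
Lemma km_moment_fun_step q m t : 1 < q ->
  km_moment_fun q m.+2 t =
  q * km_moment_fun q m t - sin (m.+2%:R * t) * sin t.
Proof.
move=> q1; have D0 := km_denom_gt0 t q1.
have := cos2sin2 t; rewrite /km_moment_fun !sin_mulnSS => cE.
move: D0; rewrite /km_denom.
move: (sin (m%:R * t)) (sin (m.+1%:R * t)) (cos t) (sin t) cE => a b c s cE D0.
have D0' : (q - 1) ^+ 2 + 4 * q * s ^+ 2 != 0 by rewrite gt_eqF.
have sE : s ^+ 2 = 1 - c ^+ 2 by rewrite cE subKr.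
by rewrite sE in D0' *; field.
Qed.

(** By the two-step recursion and the orthogonality of sines, the moment of
    index m + 2 is q times that of index m; but all moments are bounded and q >
    1, so they vanish. *)
Lemma km_moment0 q m : 2 <= q -> itv_integral (km_moment_fun q m) 0 pi = 0.
Proof.
move=> q2; have q1 : 1 < q by apply: lt_le_trans q2; rewrite ltr1n.
have step p : itv_integral (km_moment_fun q p.+2) 0 pi =
    q * itv_integral (km_moment_fun q p) 0 pi.
  have -> : km_moment_fun q p.+2 =
    (fun t => q * km_moment_fun q p t + (-1) * (sin (p.+2%:R * t) * sin t)).
    by apply/funext => t; rewrite km_moment_fun_step // mulN1r.
  have cs : continuous (fun t : R => sin (p.+2%:R * t) * sin t).
    by apply: derivable_continuous => t; apply: ex_derive.
  have cm := @continuous_km_moment_fun q p q1.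
  rewrite itv_integralD; last 2 first.
  - by move=> t; apply: cvgM; [apply: cvg_cst | apply: cm].
  - by move=> t; apply: cvgM; [apply: cvg_cst | apply: cs].
  by rewrite !itv_integralZ // integral_sin_sin mulr0 addr0.
(* crude bound: at most q + 1 over at least (q - 1)^2 *)
pose B := (q + 1) / (q - 1) ^+ 2 * pi.
have bound p : `|itv_integral (km_moment_fun q p) 0 pi| <= B.
  have -> : B = itv_integral (fun=> (q + 1) / (q - 1) ^+ 2) 0 pi.
    by rewrite itv_integral_cst ?pi_gt0 // subr0.
  apply: norm_itv_integral_le; first exact: continuous_km_moment_fun.
    by move=> t; apply: cvg_cst.
  move=> t _; rewrite /km_moment_fun normrM normfV.
  have D0 := km_denom_gt0 t q1; have q0 : 0 < q by apply: lt_trans q1.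
  rewrite (gtr0_norm D0); apply: ler_pM => //.
  - by rewrite invr_ge0 ltW.
  - rewrite normrM -[leRHS]mulr1; apply: ler_pM => //; last exact: sin_max.
    apply: le_trans (ler_normB _ _) _; apply: lerD; last exact: sin_max.
    by rewrite normrM gtr0_norm // ler_piMr ?sin_max // ltW.
  - rewrite lef_pV2 ?posrE //; first by apply: km_denom_ge; apply: ltW.
    by rewrite exprn_gt0 // subr_gt0.
have iter j : itv_integral (km_moment_fun q (j.*2 + m)) 0 pi =
    q ^+ j * itv_integral (km_moment_fun q m) 0 pi.
  elim: j => [|j IH]; first by rewrite mul1r.
  by rewrite doubleS !addSn step IH exprS mulrA.
apply/eqP; rewrite -normr_eq0; apply: contraT; rewrite neq_lt ltNge normr_ge0 /=.
set I := `|_| => I0.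
have qj j : j%:R <= q ^+ j.
  elim: j => [|j IH]; first by rewrite expr0 ler01.
  have : 1 <= q ^+ j by rewrite exprn_ege1 // ltW.
  by rewrite -natr1 exprS; nra.
have hB j : j%:R * I <= B.
  apply: le_trans (bound (j.*2 + m)%N); rewrite iter normrM -/I ler_pM2r //.
  by apply: le_trans (qj j) (ler_norm _).
have := hB (Num.bound (B / I)); rewrite -ler_pdivlMr // leNgt archi_boundP //.
by rewrite divr_ge0 ?(ltW I0) // (le_trans _ (bound 0%N)).
Qed.

(** The mass is, up to a constant, the moment of index -1, so the recursion
    expresses it through the vanishing moment of index 1 and the integral of
    sin^2. *)
Lemma km_mass q : 2 <= q ->
  itv_integral (fun t => sin t ^+ 2 / km_denom q t) 0 pi = pi / (2 * q * (q + 1)).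
Proof.
move=> q2; have q1 : 1 < q by apply: lt_le_trans q2; rewrite ltr1n.
have q0 : 0 < q by apply: lt_trans q1.
have qn : q * (q + 1) != 0 by rewrite gt_eqF // mulr_gt0 // addr_gt0.
have -> : (fun t : R => sin t ^+ 2 / km_denom q t) = fun t =>
    (q * (q + 1))^-1 * (sin t * sin t + km_moment_fun q 1 t).
  apply/funext => t; have D0 := km_denom_gt0 t q1.
  have := cos2sin2 t; rewrite /km_moment_fun !sin_mulnSS mulr0n mulr1n mul0r sin0 mul1r.
  move: D0; rewrite /km_denom.
  move: (cos t) (sin t) => c s D0 cE.
  have D0' : (q - 1) ^+ 2 + 4 * q * s ^+ 2 != 0 by rewrite gt_eqF.
  apply: (mulfI qn); rewrite mulVKf //; apply: (mulIf D0').
  rewrite -mulrA divfK // mulrDl divfK //.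
  have -> : (q * (2 * c * (2 * c * s - 0) - s) - s) * s =
    s ^+ 2 * (q * (4 * c ^+ 2 - 1) - 1) by ring.
  by rewrite cE; ring.
have cm := @continuous_km_moment_fun q 1 q1.
have cs : continuous (fun t : R => sin t * sin t).
  by apply: derivable_continuous => t; apply: ex_derive.
rewrite itv_integralZ; last by move=> t; apply: cvgD; [apply: cs|apply: cm].
rewrite itv_integralD // integral_sin2 km_moment0 // addr0.
by field; rewrite !gt_eqF // addr_gt0.
Qed.

End KestenMcKay.

(** * The Kesten-McKay measure *)

Section KestenMcKayMeasure.
Context {R : realType}.
Variable k : nat.
Hypothesis k1 : (1 < k)%N.
Implicit Types (t x : R).

Local Notation q := (k.-1%:R : R).
Local Notation s := (Num.sqrt q).

Lemma sqr_sqrt_pred : s ^+ 2 = q.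
Proof. by rewrite sqr_sqrtr // ler0n. Qed.

Lemma sqrt_pred_gt0 : 0 < s.
Proof. by rewrite sqrtr_gt0 ltr0n; case: k k1 => [|[]]. Qed.

(** Density of the Kesten-McKay measure in the variable t, where x = 2
    sqrt(k-1) cos t. For k = 2 the formula of the other branch simplifies to 1
    / pi except at the ends, where it reads 0 / 0. *)
Definition km_weight t : R :=
  if k == 2 then pi^-1 else 2 * k%:R * q / pi * (sin t ^+ 2 / km_denom q t).

Lemma natr_pred_ge2 : k != 2 -> 2 <= q.
Proof. by move=> k2; rewrite ler_nat; case: k k1 k2 => [|[|[]]]. Qed.

Lemma km_weight_ge0 t : 0 <= km_weight t.
Proof.
rewrite /km_weight; case: eqP => [_|/eqP/natr_pred_ge2 q2].
  by rewrite invr_ge0 pi_ge0.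
have D0 : 0 < km_denom q t by apply: km_denom_gt0; apply: lt_le_trans q2; rewrite ltr1n.
by rewrite mulr_ge0 // divr_ge0 ?pi_ge0 ?sqr_ge0 ?(ltW D0) // -!natrM ler0n.
Qed.

Lemma continuous_km_weight : continuous km_weight.
Proof.
rewrite /km_weight; case: eqP => [_ t|/eqP/natr_pred_ge2 q2 t]; first exact: cvg_cst.
apply: cvgM; first exact: cvg_cst.
suff h : continuous (fun t : R => sin t ^+ 2 / km_denom q t) by exact: h.
apply: continuous_div_km_denom; first by apply: lt_le_trans q2; rewrite ltr1n.
by apply: derivable_continuous => x; apply: ex_derive.
Qed.

(** The substitution x = 2 s cos t is built in, so that no change of variables
    is needed. *)
Definition km_integral (f : R -> R) : R :=
  itv_integral (fun t => f (2 * s * cos t) * km_weight t) 0 pi.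

Lemma continuous_km_integrand (f : R -> R) : continuous f ->
  continuous (fun t => f (2 * s * cos t) * km_weight t).
Proof.
move=> cf t; apply: cvgM; last exact: continuous_km_weight.
apply: (@continuous_comp _ _ _ (fun t => 2 * s * cos t) f); last exact: cf.
suff h : continuous (fun t : R => 2 * s * cos t) by exact: h.
by apply: derivable_continuous => x; apply: ex_derive.
Qed.

Lemma km_nb_poly r : km_integral (horner (nb_poly R k r)) = (r == 0)%:R.
Proof.
have s2 := sqr_sqrt_pred; have s0 := sqrt_pred_gt0; have p0 := pi_gt0 R.
rewrite /km_integral /km_weight; case: eqP => [k2|/eqP/natr_pred_ge2 q2].
  have s1 : s = 1 by rewrite k2 sqrtr1.
  have -> : (fun t => (nb_poly R k r).[2 * s * cos t] / pi) =
      (fun t => pi^-1 * (if r == 0 then 1 else 2 * cos (r%:R * t))).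
    apply/funext => t; rewrite mulrC; congr (_ * _); case: r => [|r] /=.
      by rewrite hornerC.
    by rewrite s1 mulr1 k2 nb_poly2_trig.
  case: r => [|r] /=.
    rewrite (@eq_itv_integral _ _ (fun=> pi^-1)) => [|t _]; last by rewrite mulr1.
    by rewrite itv_integral_cst // subr0 mulVf ?gt_eqF.
  have r0 : r.+1%:R != 0 :> R by rewrite pnatr_eq0.
  have dF t : is_derive t 1
      (fun t : R => pi^-1 * (2 / r.+1%:R * sin (r.+1%:R * t)))
      (pi^-1 * (2 * cos (r.+1%:R * t))).
    apply: is_derive_eq; rewrite /GRing.scale /=.
    move: r0 p0; move: (r.+1%:R : R) (@pi R) => c p c0 p0.
    by field; rewrite c0 gt_eqF.
  rewrite (itv_integral_FTC p0 _ dF).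
    by rewrite sin_natpi !mulr0 sin0 !mulr0 subrr.
  by apply: derivable_continuous => x; apply: ex_derive.
have q1 : 1 < q by apply: lt_le_trans q2; rewrite ltr1n.
have kE : k%:R = q + 1 by rewrite natr1 prednK // ltnW.
case: r => [|r].
  rewrite (@eq_itv_integral _ _
    (fun t => 2 * k%:R * q / pi * (sin t ^+ 2 / km_denom q t))); last first.
    by move=> t _; rewrite hornerC mul1r.
  rewrite itv_integralZ; last first.
    apply: continuous_div_km_denom => //.
    by apply: derivable_continuous => x; apply: ex_derive.
  rewrite km_mass // kE eqxx mulr1n; move: q q2 (@pi R) p0 => x x2 p p0.
  by field; rewrite !gt_eqF //; lra.
rewrite (@eq_itv_integral _ _ (fun t =>
    (2 * k%:R * q / pi * (s ^+ r / s)) * km_moment_fun q r t)); last first.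
  move=> t _; have sn : s != 0 by rewrite gt_eqF.
  have h : (nb_poly R k r.+1).[2 * s * cos t] * sin t =
      s ^+ r / s * (q * sin (r.+2%:R * t) - sin (r%:R * t)).
    apply: (mulfI sn); rewrite mulrA nb_poly_trig ?(ltnW k1) // s2.
    by rewrite mulrA [s * (_ / s)]mulrC divfK.
  transitivity (2 * k%:R * q / pi * ((nb_poly R k r.+1).[2 * s * cos t] * sin t
    * sin t / km_denom q t)); first by ring.
  by rewrite h /km_moment_fun; ring.
rewrite itv_integralZ; last exact: continuous_km_moment_fun.
by rewrite km_moment0 // mulr0.
Qed.

(** Substitute u = sin t: the integrand becomes a constant times u^2 / ((q -
    1)^2 + 4 q u^2), whose antiderivative is elementary. The factor 2 accounts
    for the two halves of [0, pi]. *)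
Lemma km_antiderivative : exists H : R -> R,
  [/\ forall t, is_derive t 1 (fun t => H (sin t)) (2 * s * cos t * km_weight t),
      H 0 = 0 & 2 * H 1 = energy_const R k].
Proof.
have s2 := sqr_sqrt_pred; have s0 := sqrt_pred_gt0; have p0 := pi_gt0 R.
have kE : k%:R = q + 1 by rewrite natr1 prednK // ltnW.
have ksE : k%:R - 1 = q by rewrite kE addrK.
have sn : s != 0 by rewrite gt_eqF.
have pn : pi != 0 :> R by rewrite gt_eqF.
rewrite /km_weight /energy_const ksE; move: (@pi R) p0 pn => p p0 pn.
case: eqP => [k2|/eqP/natr_pred_ge2 q2].
  have s1 : s = 1 by rewrite k2 sqrtr1.
  exists (fun x => 2 / p * x); split=> [t||]; last 2 first.
  - by rewrite mulr0.
  - by rewrite s1 k2 subrr mulr0 mul0r subr0; field.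
  by apply: is_derive_eq; rewrite /GRing.scale /= s1; field.
pose c := 2 * s / (q - 1).
have q1 : 0 < q - 1 by lra.
have q1n : q - 1 != 0 by rewrite gt_eqF.
have cn : c != 0 by rewrite gt_eqF // divr_gt0 // mulr_gt0.
exists (fun x => k%:R * s / p * (x - c^-1 * atan (c * x))); split=> [t||].
- have den : 1 + (c * sin t) ^+ 2 = km_denom q t / (q - 1) ^+ 2.
    by rewrite /c /km_denom !exprMn exprVn s2; field.
  have D0 : km_denom q t != 0 by rewrite gt_eqF // km_denom_gt0 //; lra.
  apply: is_derive_eq; rewrite /GRing.scale /= den.
  have -> : c^-1 * ((km_denom q t / (q - 1) ^+ 2)^-1 * (c * cos t)) =
      (q - 1) ^+ 2 / km_denom q t * cos t by field; rewrite D0 q1n cn.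
  have -> : cos t - (q - 1) ^+ 2 / km_denom q t * cos t =
      cos t * (4 * q * sin t ^+ 2) / km_denom q t.
    have -> : 4 * q * sin t ^+ 2 = km_denom q t - (q - 1) ^+ 2.
      by rewrite /km_denom addrC addKr.
    by field.
  by field; rewrite D0.
- by rewrite mulr0 atan0 mulr0 subr0 mulr0.
- have -> : k%:R - 2 = q - 1 by rewrite kE; ring.
  by rewrite mulr1 /c; field; rewrite pn q1n sn.
Qed.

Lemma km_integral_abs : km_integral (fun x => `|x|) = energy_const R k.
Proof.
have [H [dH H0 H1]] := km_antiderivative; have p0 := pi_gt0 R.
have ph0 : 0 < pi / 2 :> R by rewrite divr_gt0.
have phpi : pi / 2 < pi :> R by rewrite ltr_pdivrMr // ltr_pMr // ltr1n.
have cw : continuous (fun t => 2 * s * cos t * km_weight t).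
  by apply: (@continuous_km_integrand id) => x; apply: cvg_id.
have cabs := continuous_km_integrand (@norm_continuous _ R).
rewrite /km_integral (@itv_integral_split _ _ _ (pi / 2)) ?(ltW ph0) ?(ltW phpi) //.
have s0 := sqrt_pred_gt0.
rewrite (@eq_itv_integral _ _ (fun t => 2 * s * cos t * km_weight t)); last first.
  move=> t /andP[t0 t1]; rewrite ger0_norm // mulr_ge0 ?mulr_ge0 ?(ltW s0) //.
  by apply: cos_ge0_pihalf; rewrite t1 (le_trans _ t0) // oppr_le0 ltW.
rewrite [X in _ + X](@eq_itv_integral _ _
  (fun t => -1 * (2 * s * cos t * km_weight t))); last first.
  move=> t /andP[t0 t1]; rewrite ler0_norm ?mulN1r ?mulNr //.
  have : 0 <= cos (pi - t).
    by apply: cos_ge0_pihalf; apply/andP; split; lra.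
  rewrite cosB cospi sinpi mul0r addr0 mulN1r oppr_ge0 => c0.
  by rewrite mulr_ge0_le0 // mulr_ge0 // ltW.
rewrite itv_integralZ // (itv_integral_FTC ph0 cw dH) (itv_integral_FTC phpi cw dH).
by rewrite sinpi sin_pihalf sin0 H0 -H1; ring.
Qed.

Lemma km_integralD (f g : R -> R) : continuous f -> continuous g ->
  km_integral (fun x => f x + g x) = km_integral f + km_integral g.
Proof.
move=> cf cg; rewrite /km_integral -itv_integralD; try exact: continuous_km_integrand.
by apply: eq_itv_integral => t _; rewrite mulrDl.
Qed.

Lemma km_integralZ c (f : R -> R) : continuous f ->
  km_integral (fun x => c * f x) = c * km_integral f.
Proof.
move=> cf; rewrite /km_integral -itv_integralZ; last exact: continuous_km_integrand.
by apply: eq_itv_integral => t _; rewrite mulrA.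
Qed.

(** The support [-2 sqrt(k-1), 2 sqrt(k-1)] of the limit lies in the interval
    [-k, k] where approximation is known: this is (sqrt(k-1) - 1)^2 >= 0. *)
Lemma km_support : 2 * s <= k%:R.
Proof.
have kE : k%:R = q + 1 by rewrite natr1 prednK // ltnW.
rewrite kE; have := sqr_sqrt_pred; move: q s => x v <-.
by have := sqr_ge0 (v - 1); nra.
Qed.

Lemma km_integral_approx (P : {poly R}) (eps : R) :
  (forall x, `|x| <= k%:R -> `| `|x| - P.[x] | <= eps) ->
  `|energy_const R k - km_integral (horner P)| <= eps.
Proof.
move=> hP; have cP := @continuous_horner R P.
have cn := @norm_continuous _ R.
rewrite -km_integral_abs.
have -> : km_integral (fun x => `|x|) - km_integral (horner P) =
  km_integral (fun x => `|x| + (-1) * P.[x]).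
  rewrite km_integralD ?km_integralZ ?mulN1r //.
  by move=> x; apply: cvgM; [apply: cvg_cst | apply: cP].
have mass : itv_integral (fun t => eps * km_weight t) 0 pi = eps.
  rewrite itv_integralZ; last exact: continuous_km_weight.
  transitivity (eps * km_integral (horner (nb_poly R k 0))).
    congr (_ * _); apply: eq_itv_integral => t _.
    by rewrite hornerC mul1r.
  by rewrite km_nb_poly mulr1.
rewrite -[leRHS]mass /km_integral; apply: norm_itv_integral_le.
- apply: (@continuous_km_integrand (fun x => `|x| + (-1) * P.[x])).
  move=> x; apply: cvgD; first exact: cn.
  by apply: cvgM; [apply: cvg_cst | apply: cP].
- by move=> t; apply: cvgM; [apply: cvg_cst | apply: continuous_km_weight].
move=> t _; rewrite normrM (ger0_norm (km_weight_ge0 t)).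
rewrite ler_wpM2r ?km_weight_ge0 // mulN1r; apply: hP.
apply: le_trans km_support; rewrite normrM ger0_norm.
  by rewrite ler_piMr ?cos_max // mulr_ge0 // ltW ?sqrt_pred_gt0.
by rewrite mulr_ge0 // ltW ?sqrt_pred_gt0.
Qed.

End KestenMcKayMeasure.

(** * Averaged traces *)

(** In particular nb_poly is monic of degree m, which is what makes these
    polynomials span. *)
Lemma coef_nb_poly (R : comNzRingType) (k m i : nat) : (m <= i)%N ->
  (nb_poly R k m)`_i = (i == m)%:R.
Proof.
suff H p : (forall i, (p <= i)%N -> (nb_poly R k p)`_i = (i == p)%:R) /\
    (forall i, (p.+1 <= i)%N -> (nb_poly R k p.+1)`_i = (i == p.+1)%:R).
  by move=> mi; case: (H m) => + _; apply.
elim: p => [|p [IH1 IH2]].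
  split=> j _; first by rewrite [nb_poly _ _ _]/1 coef1.
  by rewrite [nb_poly _ _ _]/('X) coefX.
split=> // -[//|j] pj; rewrite nb_polySS coefB coefMX coefZ /= IH2 // IH1.
  by rewrite [j.+1 == p](_ : _ = false) ?mulr0 ?subr0 //; apply/eqP; lia.
by lia.
Qed.

Section AveragedTraces.
Context {R : realType}.
Variable k : nat.
Hypothesis k1 : (1 < k)%N.

Definition trace_error (P : {poly R}) n (G : sgraph n.+1) : R :=
  `|\tr (horner_mx (adjacency R G) P) - n.+1%:R * km_integral k (horner P)|.

(** A bound on the average over all regular graphs, uniform in n, rather than
    on the individual graphs: this form is stable under linear combinations of
    polynomials. *)
Definition traces_concentrate (P : {poly R}) := exists K : R, exists N : nat,
  forall n, (N <= n.+1)%N ->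
    \sum_(G in regular_graphs k n.+1) trace_error P G
      <= K * #|regular_graphs k n.+1|%:R.

Lemma km_integral_polyD (P Q : {poly R}) :
  km_integral k (horner (P + Q)) =
  km_integral k (horner P) + km_integral k (horner Q).
Proof.
rewrite -km_integralD //; try exact: continuous_horner.
by congr (km_integral k _); apply/funext => x; rewrite hornerD.
Qed.

Lemma km_integral_polyZ c (P : {poly R}) :
  km_integral k (horner (c *: P)) = c * km_integral k (horner P).
Proof.
rewrite -km_integralZ //; last exact: continuous_horner.
by congr (km_integral k _); apply/funext => x; rewrite hornerZ.
Qed.

Lemma traces_concentrateD P Q :
  traces_concentrate P -> traces_concentrate Q -> traces_concentrate (P + Q).
Proof.
move=> [K [N hP]] [K' [N' hQ]]; exists (K + K'), (maxn N N') => n.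
rewrite geq_max => /andP[/hP {}hP /hQ {}hQ].
rewrite mulrDl; apply: le_trans (lerD hP hQ).
rewrite -big_split /=; apply: ler_sum => G _.
rewrite /trace_error km_integral_polyD mulrDr rmorphD /= mxtraceD.
by rewrite opprD addrACA ler_normD.
Qed.

Lemma traces_concentrateZ c P :
  traces_concentrate P -> traces_concentrate (c *: P).
Proof.
move=> [K [N hP]]; exists (`|c| * K), N => n /hP {}hP.
rewrite -mulrA; apply: le_trans (ler_wpM2l (normr_ge0 c) hP).
rewrite mulr_sumr; apply: ler_sum => G _.
rewrite /trace_error km_integral_polyZ linearZ /= mxtraceZ -normrM.
by rewrite mulrBr mulrCA.
Qed.

(** The traces are nonnegative for r > 0, so their averages are controlled by
    the counts of short-cycle edges. *)
Lemma traces_concentrate_nb_poly r : traces_concentrate (nb_poly R k r).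
Proof.
case: r => [|r].
  exists 0, 0%N => n _; rewrite mul0r big1 // => G _.
  rewrite /trace_error km_nb_poly // eqxx mulr1.
  by rewrite [nb_poly _ _ _]/1 rmorph1 mxtrace1 subrr normr0.
pose C := (k ^ r.+1 * (\sum_(i < r.+1) k ^ i))%N.
exists (C * \sum_(m < r.+1) k ^ m.+2)%N%:R, (r.+3 * k + 2 * k ^ 2)%N => n nN.
rewrite -natrM; apply: (@le_trans _ _
  (\sum_(G : sgraph n.+1 | regular k G) closed_nb_walks G r)%N%:R).
  rewrite natr_sum (eq_bigl (fun G => regular k G)) => [|G]; last by rewrite inE.
  apply: ler_sum => G rG.
  rewrite /trace_error km_nb_poly // mulr0 subr0 mxtrace_nb_poly //.
  by rewrite normr_nat.
rewrite ler_nat; apply: (@leq_trans (\sum_(G : sgraph n.+1 | regular k G)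
  C * \sum_(m < r.+1) #|short_cycle_edges G m|)%N).
  by apply: leq_sum => G rG; apply: closed_nb_walks_le.
rewrite -big_distrr /= -mulnA leq_mul2l; apply/orP; right.
rewrite exchange_big /= big_distrl /=; apply: leq_sum => m _.
rewrite mulnC; apply: sum_short_cycle_edges_le => //.
apply: leq_trans nN; rewrite leq_add2r leq_mul2r; apply/orP; right.
by have := ltn_ord m; lia.
Qed.

Lemma traces_concentrate_all P : traces_concentrate P.
Proof.
have [m] := ubnP (size P); elim: m P => [//|[|m] IH] P; rewrite ltnS => sP.
  have -> : P = 0 *: nb_poly R k 0.
    by rewrite scale0r; apply/eqP; rewrite -size_poly_leq0.
  exact/traces_concentrateZ/traces_concentrate_nb_poly.
have -> : P = P`_m *: nb_poly R k m + (P - P`_m *: nb_poly R k m).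
  by rewrite addrC subrK.
apply: traces_concentrateD.
  exact/traces_concentrateZ/traces_concentrate_nb_poly.
apply: IH; rewrite ltnS; apply/leq_sizeP => j mj.
rewrite coefB coefZ coef_nb_poly //; case: eqVneq => [->|jm].
  by rewrite mulr1 subrr.
rewrite mulr0 subr0; move/leq_sizeP: sP; apply.
by rewrite ltn_neqAle eq_sym jm.
Qed.

(** Two errors of size e n: from replacing |x| by P on the spectrum and under
    the limit measure. *)
Lemma energy_error (P : {poly R}) (e : R) n (G : sgraph n.+1) : regular k G ->
  (forall x, `|x| <= k%:R -> `| `|x| - P.[x] | <= e) ->
  `|energy R G - energy_const R k * n.+1%:R| <=
    2 * e * n.+1%:R + trace_error P G.
Proof.
move=> rG hP.
have [d [chA trA]] := real_symmetric_spectrum (adjacency_sym R G).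
have dk i : `|d i| <= k%:R.
  apply: (regular_eigenvalue_le rG); rewrite eigenvalue_root_char chA.
  by rewrite (bigD1 i) //= rootM root_XsubC eqxx.
rewrite (energyE chA).
have -> : \sum_i `|d i| - energy_const R k * n.+1%:R =
  \sum_i (`|d i| - P.[d i]) +
  (\tr (horner_mx (adjacency R G) P) - n.+1%:R * km_integral k (horner P)) -
  n.+1%:R * (energy_const R k - km_integral k (horner P)).
  by rewrite sumrB trA; ring.
apply: le_trans (ler_normB _ _) _.
have h1 : `|\sum_i (`|d i| - P.[d i])| <= e * n.+1%:R.
  apply: le_trans (ler_norm_sum _ _ _) _.
  apply: (@le_trans _ _ (\sum_(i < n.+1) e)).
    by apply: ler_sum => i _; apply: hP.
  by rewrite sumr_const card_ord mulr_natr.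
have h2 : `|n.+1%:R * (energy_const R k - km_integral k (horner P))| <=
    e * n.+1%:R.
  by rewrite normrM normr_nat mulrC ler_wpM2r // km_integral_approx.
apply: le_trans (lerD (ler_normD _ _) h2) _.
by rewrite /trace_error; lra.
Qed.

(** Markov's inequality: with e = eps / 4, a bad graph has trace error at least
    eps n / 2, while the average trace error is bounded. *)
Lemma few_bad_energies (eps : R) : 0 < eps -> exists K : R, exists N : nat,
  forall n, (N <= n.+1)%N ->
    n.+1%:R * #|[set G in regular_graphs k n.+1 |
      ~~ (`|energy R G - energy_const R k * n.+1%:R| <= eps * n.+1%:R)]%SET|%:R
    <= K * #|regular_graphs k n.+1|%:R.
Proof.
move=> eps0; have k0 : 0 < k%:R :> R by rewrite ltr0n ltnW.
have e0 : 0 < eps / 4 by rewrite divr_gt0.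
have [P hP] := abs_poly_approx k0 e0.
have [K [N hK]] := traces_concentrate_all P.
exists (2 / eps * K), N => n /hK {}hK.
rewrite -[leRHS]mulrA -ler_pdivrMl ?divr_gt0 //; apply: le_trans hK.
set B := [set G in _ | _]%SET.
rewrite (big_setID B) /= -[leLHS]addr0; apply: lerD; last first.
  by apply: sumr_ge0 => G _; apply: normr_ge0.
have -> : (2 / eps)^-1 * (n.+1%:R * #|B|%:R) = \sum_(G in B) (eps / 2 * n.+1%:R).
  by rewrite sumr_const -[RHS]mulr_natr invf_div !mulrA.
have -> : regular_graphs k n.+1 :&: B = B.
  by apply/finset.setIidPr/fintype.subsetP => G; rewrite !inE => /andP[].
apply: ler_sum => G; rewrite !inE -ltNge => /andP[rG bad].
have := energy_error rG hP; lra.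
Qed.
End AveragedTraces.

Theorem theorem17 (R : realType) (k : nat) (hk : (2 <= k)%N)
    (eps : R) (heps : 0 < eps) :
  (fun n : nat =>
     prob_regular R k (fun G : sgraph n =>
       `|energy R G - energy_const R k * n%:R| <= eps * n%:R))
    @ within [set n : nat | ~~ odd (k * n)] \oo --> (1 : R).
Proof.
have [K [N hK]] := few_bad_energies hk heps.
apply/cvgrPdist_le => e e0.
have [M hM] : exists M : nat, K / e < M%:R.
  exists (Num.bound (`|K| / e)); apply: le_lt_trans (archi_boundP _).
    by rewrite ler_pM2r ?invr_gt0 // ler_norm.
  by rewrite divr_ge0 // ltW.
(* n > k makes regular graphs exist, n >= M makes the Markov bound K / n at most e *)
exists (maxn N (maxn k.+1 M)) => // n /=.
rewrite !geq_max => /andP[Nn /andP[kn Mn]] okn.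
case: n Nn kn Mn okn => [//|n] Nn kn Mn okn.
have [G0 rG0] := regular_exists kn okn.
have := hK n Nn; rewrite /prob_regular.
set A := [set G : sgraph n.+1 | regular k G & _]%SET.
rewrite -/(regular_graphs k n.+1).
set B := [set G in _ | _]%SET; set S := regular_graphs k n.+1 => hB.
have S0 : 0 < #|S|%:R :> R.
  by rewrite ltr0n; apply/card_gt0P; exists G0; rewrite inE.
have SAB : #|S|%:R = #|A|%:R + #|B|%:R :> R.
  rewrite -natrD -(cardsID A S); congr ((_ + _)%:R)%N; apply: eq_card => G.
    by rewrite !inE andbA andbb.
  by rewrite !inE andbC; case: (regular _ _); rewrite ?andbF.
have -> : 1 - #|A|%:R / #|S|%:R = #|B|%:R / #|S|%:R :> R.
  have Sn := lt0r_neq0 S0.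
  by apply: (mulIf Sn); rewrite mulrBl !divfK // mul1r SAB addrC addKr.
rewrite ger0_norm ?divr_ge0 // ler_pdivrMr //.
rewrite -(ler_pM2l (x := n.+1%:R)) ?ltr0n //; apply: le_trans hB _.
rewrite mulrA ler_pM2r //; move: hM; rewrite ltr_pdivrMr // => /ltW/le_trans; apply.
by rewrite ler_pM2r // ler_nat.
Qed.
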